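(* If $A$ is a nonzero commutative ring, then $K_0(A)$ and $H_0(A)$ are infinite rings of characteristic zero.
   Context: $K_0(A)$ is the Grothendieck ring of the semiring of isomorphism classes of finitely generated projective $A$-modules (addition $\oplus$, multiplication $\otimes_A$). $H_0(A)$ is the ring (under pointwise operations) of all continuous functions $\operatorname{Spec}(A)\to\mathbb{Z}$, where $\operatorname{Spec}(A)$ has the Zariski topology and $\mathbb{Z}$ the discrete topology. *)

(* Defs.v *)
From HB Require Import structures.
From mathcomp Require Import all_boot all_order all_algebra.
From mathcomp Require Import all_classical topology ring.

Set Implicit Arguments.
Unset Strict Implicit.
Unset Printing Implicit Defensive.

Import GRing.Theory.
Local Open Scope ring_scope.
Local Open Scope classical_set_scope.
Local Open Scope quotient_scope.

Section Modules.
Variable A : comNzRingType.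
Implicit Types M N P Q : lmodType A.

Definition fin_gen M : Prop :=
  exists (n : nat) (v : 'I_n -> M),
    forall x : M, exists c : 'I_n -> A, x = \sum_i c i *: v i.

Definition projective M : Prop :=
  forall N P (g : {linear N -> P}) (f : {linear M -> P}),
    (forall y, exists x, g x = y) ->
    exists h : {linear M -> N}, forall x, g (h x) = f x.

Definition fgproj M : Prop := fin_gen M /\ projective M.

Definition lmod_iso M N : Prop := exists f : {linear M -> N}, bijective f.

Lemma mk_linear M N (f : M -> N) :
  linear f -> exists g : {linear M -> N}, g =1 f.
Proof.
move=> lf; pose fL := GRing.isLinear.Build A M N _ f lf.
by exists (HB.pack_for {linear M -> N} f fL).
Qed.

Lemma mk_iso M N (f : M -> N) (g : N -> M) :
  linear f -> cancel f g -> cancel g f -> lmod_iso M N.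
Proof.
move=> /mk_linear[h hE] fK gK; exists h; exists g => x; rewrite hE.
  exact: fK.
exact: gK.
Qed.

Lemma lmod_iso_refl M : lmod_iso M M.
Proof. exact: (@mk_iso M M id id). Qed.

Lemma lmod_iso_elim M N : lmod_iso M N ->
  exists (f : {linear M -> N}) (g : {linear N -> M}), cancel f g /\ cancel g f.
Proof.
move=> [f [g fK gK]]; have /mk_linear[h hE] : linear g.
  by move=> a x y; apply: (can_inj fK); rewrite linearP !gK.
exists f, h; split=> x; rewrite hE; [exact: fK|exact: gK].
Qed.

Lemma lmod_iso_sym M N : lmod_iso M N -> lmod_iso N M.
Proof. by move=> /lmod_iso_elim[f [g [fK gK]]]; exists g; exists f. Qed.

Lemma lmod_iso_trans M N P : lmod_iso M N -> lmod_iso N P -> lmod_iso M P.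
Proof.
by move=> [f fb] [g gb]; exists (g \o f : {linear M -> P}); exact: bij_comp.
Qed.

Lemma fgprojP M : fgproj M <->
  exists n (i : {linear M -> 'rV[A]_n}) (p : {linear 'rV[A]_n -> M}), cancel i p.
Proof.
split=> [[[n [v vP]] pM]|[n [i [p ipK]]]].
  have /mk_linear[g gE] : linear (fun r : 'rV[A]_n => \sum_i r 0 i *: v i).
    move=> a x y; rewrite scaler_sumr -big_split /=; apply: eq_bigr => i _.
    by rewrite !mxE scalerDl scalerA.
  have [] := pM 'rV[A]_n M g idfun.
    move=> y; have [c ->] := vP y; exists (\row_i c i); rewrite gE.
    by apply: eq_bigr => i _; rewrite mxE.
  by move=> h hE; exists n, h, g.
have E x : x = \sum_k i x 0 k *: p (delta_mx 0 k).
  rewrite -{1}[x]ipK [i x]row_sum_delta linear_sum.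
  by apply: eq_bigr => k _; rewrite linearZ -row_sum_delta.
split; first by exists n, (fun k => p (delta_mx 0 k)) => x; exists (i x 0).
move=> N P g f gs.
pose y k := sval (cid (gs (f (p (delta_mx 0 k))))).
have /mk_linear[h hE] : linear (fun x => \sum_k i x 0 k *: y k).
  move=> a u v; rewrite scaler_sumr -big_split /=; apply: eq_bigr => k _.
  by rewrite linearP !mxE scalerDl scalerA.
exists h => x; rewrite hE [in RHS](E x) !linear_sum; apply: eq_bigr => k _.
by rewrite !linearZ /= /y; case: cid => /= ? ->.
Qed.

Lemma fgproj_retract M N (i : {linear M -> N}) (p : {linear N -> M}) :
  cancel i p -> fgproj N -> fgproj M.
Proof.
move=> ipK /fgprojP[n [j [q jqK]]]; apply/fgprojP.
exists n, (j \o i : {linear _ -> _}), (p \o q : {linear _ -> _}) => x /=.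
by rewrite jqK ipK.
Qed.

Lemma fgproj_iso M N : lmod_iso M N -> fgproj M -> fgproj N.
Proof. by move=> /lmod_iso_elim[f [g [_ /fgproj_retract]]]; exact. Qed.

Lemma fgproj_mx m n : fgproj 'M[A]_(m, n).
Proof.
apply/fgprojP; exists (m * n)%N.
by exists (mxvec : {linear _ -> _}), (vec_mx : {linear _ -> _}); exact: mxvecK.
Qed.

Lemma fgproj_regular : fgproj A^o.
Proof.
apply: (fgproj_iso _ (fgproj_mx 1 1)).
apply: (@mk_iso _ _ (fun r : 'M[A]_1 => r 0 0 : A^o) (fun a => const_mx a)).
- by move=> a x y; rewrite !mxE.
- by move=> r; apply/matrixP=> i j; rewrite mxE !ord1.
- by move=> a; rewrite mxE.
Qed.

Lemma fgproj_pair M N : fgproj M -> fgproj N -> fgproj (M * N)%type.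
Proof.
move=> /fgprojP[m [i [p ipK]]] /fgprojP[n [j [q jqK]]]; apply/fgprojP.
have /mk_linear[f fE] : linear (fun x : M * N => row_mx (i x.1) (j x.2)).
  by move=> a x y; rewrite /= !linearP scale_row_mx add_row_mx.
have /mk_linear[g gE] : linear (fun r : 'rV[A]_(m + n) =>
    (p (lsubmx r), q (rsubmx r)) : (M * N)%type).
  by move=> a x y; rewrite !linearP.
by exists (m + n)%N, f, g => -[x y]; rewrite gE fE row_mxKl row_mxKr ipK jqK.
Qed.

End Modules.

(* Elements of the tensor product are represented by formal finite sums of    *)
(* pairs (x, y), standing for sums of elementary tensors; two formal sums are *)
(* identified when every bilinear map takes the same value on them, i.e.      *)
(* modulo the relations forced by the universal property, which is            *)
(* tensor_universal below.                                                    *)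
Section Tensor.
Variables (A : comNzRingType) (M N : lmodType A).

Definition formal_eval (P : lmodType A) (b : M -> N -> P) (s : seq (M * N)) : P :=
  \sum_(p <- s) b p.1 p.2.

Definition tensor_rel : rel (seq (M * N)) := fun s t =>
  `[< forall (P : lmodType A) (b : {bilinear M -> N -> P}),
        formal_eval b s = formal_eval b t >].

Lemma tensor_rel_equiv : equiv_class_of tensor_rel.
Proof.
split.
- by move=> s; apply/asboolP.
- by move=> s t; apply/asboolP/asboolP => st P b; rewrite st.
- move=> t s u /asboolP st /asboolP tu; apply/asboolP => P b.
  by rewrite st tu.
Qed.
Canonical tensor_equiv := EquivRelPack tensor_rel_equiv.

Definition tensor := {eq_quot tensor_rel}.
HB.instance Definition _ : EqQuotient _ tensor_rel tensor :=
  EqQuotient.on tensor.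
HB.instance Definition _ := Choice.on tensor.

Implicit Types (x y z : tensor) (s t : seq (M * N)).

Definition tensor_lift (P : lmodType A) (b : M -> N -> P) x : P :=
  formal_eval b (repr x).

Definition tensor_add x y : tensor := \pi_tensor (repr x ++ repr y).
Definition tensor_scale (a : A) x : tensor :=
  \pi_tensor [seq (a *: p.1, p.2) | p <- repr x].
Definition tensor_pure (u : M) (v : N) : tensor := \pi_tensor [:: (u, v)].

Lemma tensor_lift_pi (P : lmodType A) (b : {bilinear M -> N -> P}) s :
  tensor_lift b (\pi_tensor s) = formal_eval b s.
Proof.
rewrite /tensor_lift.
have /eqmodP/asboolP : repr (\pi_tensor s) = s %[mod tensor] by rewrite reprK.
exact.
Qed.

Lemma tensor_eqP x y :
  (forall (P : lmodType A) (b : {bilinear M -> N -> P}),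
     tensor_lift b x = tensor_lift b y) -> x = y.
Proof. by move=> xy; rewrite -[x]reprK -[y]reprK; apply/eqmodP/asboolP. Qed.

Lemma tensor_lift_add (P : lmodType A) (b : {bilinear M -> N -> P}) x y :
  tensor_lift b (tensor_add x y) = tensor_lift b x + tensor_lift b y.
Proof. by rewrite tensor_lift_pi /formal_eval big_cat. Qed.

Lemma tensor_lift_scale (P : lmodType A) (b : {bilinear M -> N -> P}) a x :
  tensor_lift b (tensor_scale a x) = a *: tensor_lift b x.
Proof.
rewrite tensor_lift_pi /formal_eval big_map /= scaler_sumr.
by apply: eq_bigr => p _; rewrite linearZl_LR.
Qed.

Lemma tensor_lift_zero (P : lmodType A) (b : {bilinear M -> N -> P}) :
  tensor_lift b (\pi_tensor [::]) = 0.
Proof. by rewrite tensor_lift_pi /formal_eval big_nil. Qed.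

Definition tlE := (tensor_lift_add, tensor_lift_scale, tensor_lift_zero).

Fact tensor_addA : associative tensor_add.
Proof. by move=> x y z; apply: tensor_eqP => P b; rewrite !tlE addrA. Qed.
Fact tensor_addC : commutative tensor_add.
Proof. by move=> x y; apply: tensor_eqP => P b; rewrite !tlE addrC. Qed.
Fact tensor_add0 : left_id (\pi_tensor [::]) tensor_add.
Proof. by move=> x; apply: tensor_eqP => P b; rewrite !tlE add0r. Qed.
Fact tensor_addN : left_inverse (\pi_tensor [::]) (tensor_scale (-1)) tensor_add.
Proof. by move=> x; apply: tensor_eqP => P b; rewrite !tlE scaleN1r addNr. Qed.
HB.instance Definition _ := GRing.isZmodule.Build tensor
  tensor_addA tensor_addC tensor_add0 tensor_addN.

Fact tensor_scaleA a b x :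
  tensor_scale a (tensor_scale b x) = tensor_scale (a * b) x.
Proof. by apply: tensor_eqP => P c; rewrite !tlE scalerA. Qed.
Fact tensor_scale1 : left_id 1 tensor_scale.
Proof. by move=> x; apply: tensor_eqP => P b; rewrite !tlE scale1r. Qed.
Fact tensor_scaleDr : right_distributive tensor_scale +%R.
Proof. by move=> a x y; apply: tensor_eqP => P b; rewrite !tlE scalerDr. Qed.
Fact tensor_scaleDl x : {morph tensor_scale^~ x : a b / a + b}.
Proof. by move=> a b; apply: tensor_eqP => P c; rewrite !tlE scalerDl. Qed.
HB.instance Definition _ := GRing.Zmodule_isLmodule.Build A tensor
  tensor_scaleA tensor_scale1 tensor_scaleDr tensor_scaleDl.

Lemma tensor_lift_linear (P : lmodType A) (b : {bilinear M -> N -> P}) :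
  linear (tensor_lift b).
Proof. by move=> a x y; rewrite tensor_lift_add tensor_lift_scale. Qed.

Lemma tensor_lift_pure (P : lmodType A) (b : {bilinear M -> N -> P}) u v :
  tensor_lift b (tensor_pure u v) = b u v.
Proof. by rewrite tensor_lift_pi /formal_eval big_seq1. Qed.

Lemma tensor_pure_bilinear : bilinear_for *:%R *:%R tensor_pure.
Proof.
split=> [v|u] a x y; apply: tensor_eqP => P b.
  by rewrite tensor_lift_linear !tensor_lift_pure linearPl.
by rewrite tensor_lift_linear !tensor_lift_pure linearPr.
Qed.
HB.instance Definition _ := bilinear_isBilinear.Build A M N tensor *:%R *:%R
  tensor_pure tensor_pure_bilinear.

Lemma tensor_sum_pure x : x = \sum_(p <- repr x) tensor_pure p.1 p.2.
Proof.
apply: tensor_eqP => P b.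
have /mk_linear[f fE] := tensor_lift_linear b.
rewrite -!fE linear_sum fE; apply: eq_bigr => p _.
by rewrite fE tensor_lift_pure.
Qed.

Lemma tensor_linear_ext (P : lmodType A) (f g : tensor -> P) :
  linear f -> linear g ->
  (forall u v, f (tensor_pure u v) = g (tensor_pure u v)) -> f =1 g.
Proof.
move=> /mk_linear[f' fE] /mk_linear[g' gE] fg x.
rewrite -fE -gE (tensor_sum_pure x) !linear_sum; apply: eq_bigr => p _.
by rewrite fE gE fg.
Qed.

Lemma tensor_lift_exists (P : lmodType A) (b : M -> N -> P) :
  bilinear_for *:%R *:%R b ->
  exists f : {linear tensor -> P}, forall u v, f (tensor_pure u v) = b u v.
Proof.
move=> bb; pose bB := bilinear_isBilinear.Build A M N P *:%R *:%R b bb.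
pose b' := HB.pack_for {bilinear M -> N -> P} b bB.
have /mk_linear[f fE] := tensor_lift_linear b'.
by exists f => u v; rewrite fE tensor_lift_pure.
Qed.

Lemma tensor_universal (P : lmodType A) (b : {bilinear M -> N -> P}) :
  exists f : {linear tensor -> P}, (forall u v, f (tensor_pure u v) = b u v) /\
    forall g : {linear tensor -> P},
      (forall u v, g (tensor_pure u v) = b u v) -> g =1 f.
Proof.
have /mk_linear[f fE] := tensor_lift_linear b.
have fb u v : f (tensor_pure u v) = b u v by rewrite fE tensor_lift_pure.
exists f; split=> // g gb.
by apply: tensor_linear_ext => [||u v]; rewrite ?gb ?fb //; exact: linearP.
Qed.

End Tensor.

Section TensorTheory.
Variable A : comNzRingType.
Implicit Types M N P Q : lmodType A.

Lemma tensor_purePl M N v a (u u' : M) :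
  tensor_pure (a *: u + u') v = a *: tensor_pure u v + tensor_pure u' v :> tensor M N.
Proof. exact: (tensor_pure_bilinear M N).1. Qed.

Lemma tensor_purePr M N u a (v v' : N) :
  tensor_pure u (a *: v + v') = a *: tensor_pure u v + tensor_pure u v' :> tensor M N.
Proof. exact: (tensor_pure_bilinear M N).2. Qed.

Lemma tensor_pure0l M N (v : N) : tensor_pure (0 : M) v = 0.
Proof.
have := tensor_purePl v (-1) 0 (0 : M).
by rewrite scaleN1r oppr0 addr0 scaleN1r addNr.
Qed.

Lemma tensor_pure0r M N (u : M) : tensor_pure u (0 : N) = 0.
Proof.
have := tensor_purePr u (-1) 0 (0 : N).
by rewrite scaleN1r oppr0 addr0 scaleN1r addNr.
Qed.

Lemma tensor_pureZl M N a (u : M) (v : N) :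
  tensor_pure (a *: u) v = a *: tensor_pure u v.
Proof. by rewrite -[a *: u]addr0 tensor_purePl tensor_pure0l addr0. Qed.

Lemma tensor_pureZr M N a (u : M) (v : N) :
  tensor_pure u (a *: v) = a *: tensor_pure u v.
Proof. by rewrite -[a *: v]addr0 tensor_purePr tensor_pure0r addr0. Qed.

Lemma tensor_pureDl M N (u u' : M) (v : N) :
  tensor_pure (u + u') v = tensor_pure u v + tensor_pure u' v.
Proof. by rewrite -[u]scale1r tensor_purePl !scale1r. Qed.

Lemma tensor_pureDr M N (u : M) (v v' : N) :
  tensor_pure u (v + v') = tensor_pure u v + tensor_pure u v'.
Proof. by rewrite -[v]scale1r tensor_purePr !scale1r. Qed.

Lemma tensor_ext M N P (f g : {linear tensor M N -> P}) :
  (forall u v, f (tensor_pure u v) = g (tensor_pure u v)) -> f =1 g.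
Proof. by apply: tensor_linear_ext; exact: linearP. Qed.

Lemma tensor_map M N M' N' (f : {linear M -> M'}) (g : {linear N -> N'}) :
  exists h : {linear tensor M N -> tensor M' N'},
    forall u v, h (tensor_pure u v) = tensor_pure (f u) (g v).
Proof.
apply: tensor_lift_exists; split=> [v|u] a x y; rewrite linearP.
  exact: tensor_purePl.
exact: tensor_purePr.
Qed.

Lemma tensor_swap M N : exists h : {linear tensor M N -> tensor N M},
  forall u v, h (tensor_pure u v) = tensor_pure v u.
Proof.
apply: (@tensor_lift_exists _ _ _ _ (fun u v => tensor_pure v u)).
split=> [v|u] a x y.
  exact: tensor_purePr.
exact: tensor_purePl.
Qed.

Lemma tensor_reassoc M N P :
  exists h : {linear tensor M (tensor N P) -> tensor (tensor M N) P},
    forall u v w, h (tensor_pure u (tensor_pure v w)) =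
                  tensor_pure (tensor_pure u v) w.
Proof.
have F u : exists f : {linear tensor N P -> tensor (tensor M N) P},
    forall v w, f (tensor_pure v w) = tensor_pure (tensor_pure u v) w.
  apply: (@tensor_lift_exists _ _ _ _ (fun v w => tensor_pure (tensor_pure u v) w)).
  split=> [w|v] a x y; last exact: tensor_purePr.
  by rewrite tensor_purePr tensor_purePl.
pose f u := sval (cid (F u)).
have fE u v w : f u (tensor_pure v w) = tensor_pure (tensor_pure u v) w.
  by rewrite /f; case: cid.
have [h hE] : exists h : {linear tensor M (tensor N P) -> tensor (tensor M N) P},
    forall u t, h (tensor_pure u t) = f u t.
  apply: tensor_lift_exists; split=> [t|u] a x y; last exact: linearP.
  have /mk_linear[g gE] : linear (fun t => a *: f x t + f y t).
    move=> c s r; rewrite (linearP (f x)) (linearP (f y)) !scalerDr !scalerA.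
    by rewrite (mulrC a) addrACA.
  rewrite -gE; apply: tensor_ext => v w.
  by rewrite gE !fE tensor_purePl tensor_purePl.
by exists h => u v w; rewrite hE fE.
Qed.

Lemma tensor_isoC M N : lmod_iso (tensor M N) (tensor N M).
Proof.
have [f fE] := tensor_swap M N; have [g gE] := tensor_swap N M.
exists f; exists g.
- by apply: (tensor_ext (f := g \o f) (g := idfun)) => u v; rewrite /= fE gE.
- by apply: (tensor_ext (f := f \o g) (g := idfun)) => u v; rewrite /= gE fE.
Qed.

Lemma tensor_iso M N M' N' : lmod_iso M M' -> lmod_iso N N' ->
  lmod_iso (tensor M N) (tensor M' N').
Proof.
move=> /lmod_iso_elim[f [g [fK gK]]] /lmod_iso_elim[f' [g' [f'K g'K]]].
have [h hE] := tensor_map f f'; have [k kE] := tensor_map g g'.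
exists h; exists k.
- apply: (tensor_ext (f := k \o h) (g := idfun)) => u v.
  by rewrite /= hE kE fK f'K.
- apply: (tensor_ext (f := h \o k) (g := idfun)) => u v.
  by rewrite /= kE hE gK g'K.
Qed.

Lemma tensor_ext_r M N P Q (f g : {linear tensor M (tensor N P) -> Q}) :
  (forall u v w, f (tensor_pure u (tensor_pure v w)) =
                 g (tensor_pure u (tensor_pure v w))) -> f =1 g.
Proof.
move=> fg; apply: tensor_ext => u.
by apply: tensor_linear_ext => [a x y|a x y|v w //];
  rewrite tensor_purePr linearP.
Qed.

Lemma tensor_ext_l M N P Q (f g : {linear tensor (tensor M N) P -> Q}) :
  (forall u v w, f (tensor_pure (tensor_pure u v) w) =
                 g (tensor_pure (tensor_pure u v) w)) -> f =1 g.
Proof.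
move=> fg; apply: tensor_ext => t w; move: t.
by apply: tensor_linear_ext => [a x y|a x y|u v //];
  rewrite tensor_purePl linearP.
Qed.

Lemma tensor_isoA M N P :
  lmod_iso (tensor M (tensor N P)) (tensor (tensor M N) P).
Proof.
have [f fE] := tensor_reassoc M N P.
have [s1 s1E] := tensor_swap (tensor M N) P.
have [s s2E] := tensor_swap M N; have [s2 s2E'] := tensor_map (idfun : {linear P -> P}) s.
have [g gE] := tensor_reassoc P N M.
have [s3 s3E] := tensor_swap (tensor P N) M.
have [s' s4E] := tensor_swap P N; have [s4 s4E'] := tensor_map (idfun : {linear M -> M}) s'.
pose k : {linear _ -> _} := s4 \o (s3 \o (g \o (s2 \o s1))).
have kE u v w : k (tensor_pure (tensor_pure u v) w) =
    tensor_pure u (tensor_pure v w).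
  by rewrite /= s1E s2E' s2E gE s3E s4E' s4E.
clearbody k; exists f; exists k.
- by apply: (tensor_ext_r (f := k \o f) (g := idfun)) => u v w; rewrite [LHS]/= fE kE.
- by apply: (tensor_ext_l (f := f \o k) (g := idfun)) => u v w; rewrite [LHS]/= kE fE.
Qed.

Lemma tensor_iso1 M : lmod_iso (tensor A^o M) M.
Proof.
have [f fE] : exists f : {linear tensor A^o M -> M},
    forall (a : A^o) v, f (tensor_pure a v) = (a : A) *: v.
  apply: (@tensor_lift_exists _ A^o M M (fun a v => (a : A) *: v)).
  split=> [v|u] a x y; first by rewrite scalerDl; congr (_ + _); exact/esym/scalerA.
  rewrite scalerDr; congr (_ + _).
  exact: (etrans (scalerA _ _ _) (etrans (congr1 ( *:%R^~ x) (mulrC (u : A) a)) (esym (scalerA _ _ _)))).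
have /mk_linear[g gE] : linear (fun v : M => tensor_pure (1 : A^o) v).
  by move=> a x y; rewrite tensor_purePr.
exists f; exists g => [|v]; last by rewrite gE fE scale1r.
apply: (tensor_ext (f := g \o f) (g := idfun)) => a v /=.
rewrite fE gE tensor_pureZr -tensor_pureZl.
by congr tensor_pure; exact: mulr1.
Qed.

Lemma tensor_isoDl M N P :
  lmod_iso (tensor (M * N)%type P) (tensor M P * tensor N P)%type.
Proof.
pose b (u : M * N) (w : P) := (tensor_pure u.1 w, tensor_pure u.2 w).
have [f fE] : exists f : {linear tensor (M * N)%type P -> (tensor M P * tensor N P)%type},
    forall u w, f (tensor_pure u w) = b u w.
  apply: tensor_lift_exists; split=> [w|u] a x y; rewrite /b /=.
    by rewrite !tensor_purePl.
  by rewrite !tensor_purePr.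
have /mk_linear[i iE] : linear (fun u : M => (u, 0) : (M * N)%type).
  by move=> a x y; congr pair; rewrite /= scaler0 addr0.
have /mk_linear[j jE] : linear (fun v : N => (0, v) : (M * N)%type).
  by move=> a x y; congr pair; rewrite /= scaler0 addr0.
have [g gE] := tensor_map i (idfun : {linear P -> P}).
have [h hE] := tensor_map j (idfun : {linear P -> P}).
have /mk_linear[k kE] : linear (fun t : tensor M P * tensor N P => g t.1 + h t.2).
  by move=> a x y; rewrite /= !linearP scalerDr addrACA.
exists f; exists k.
- apply: (tensor_ext (f := k \o f) (g := idfun)) => -[u v] w /=.
  rewrite fE kE /b /= gE hE iE jE /= -tensor_pureDl; congr tensor_pure.
  by congr pair; rewrite /= ?addr0 ?add0r.
- have fg t : f (g t) = (t, 0).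
    have /mk_linear[l lE] : linear (fun t : tensor M P => (t, 0) : (tensor M P * tensor N P)%type).
      by move=> a x y; congr pair; rewrite /= scaler0 addr0.
    rewrite -lE; apply: (tensor_ext (f := f \o g)) => u w /=.
    by rewrite lE gE fE iE /b /= tensor_pure0l.
  have fh t : f (h t) = (0, t).
    have /mk_linear[l lE] : linear (fun t : tensor N P => (0, t) : (tensor M P * tensor N P)%type).
      by move=> a x y; congr pair; rewrite /= scaler0 addr0.
    rewrite -lE; apply: (tensor_ext (f := f \o h)) => u w /=.
    by rewrite lE hE fE jE /b /= tensor_pure0l.
  by move=> [t s]; rewrite kE linearD fg fh; congr pair; rewrite /= ?addr0 ?add0r.
Qed.

Lemma tensor_iso0 M : lmod_iso (tensor 'rV[A]_0 M) 'rV[A]_0.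
Proof.
apply: (@mk_iso _ _ _ (fun=> 0) (fun=> 0)).
- by move=> a x y; rewrite scaler0 addr0.
- have /mk_linear[z zE] : linear (fun _ : tensor 'rV[A]_0 M => 0 : tensor 'rV[A]_0 M).
    by move=> a x y; rewrite scaler0 addr0.
  move=> x; rewrite -[LHS](zE x).
  apply: (tensor_ext (g := idfun)) => u v /=.
  by rewrite zE [u]thinmx0 tensor_pure0l.
- by move=> x; rewrite [x]thinmx0.
Qed.

Lemma fgproj_tensor M N : fgproj M -> fgproj N -> fgproj (tensor M N).
Proof.
move=> /fgprojP[m [i [p ipK]]] /fgprojP[n [j [q jqK]]].
have [f fE] : exists f : {linear tensor M N -> 'M[A]_(m, n)},
    forall u v, f (tensor_pure u v) = (i u)^T *m j v.
  apply: (@tensor_lift_exists _ _ _ _ (fun u v => (i u)^T *m j v)).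
  split=> [v|u] a x y; rewrite linearP.
    by rewrite linearP /= mulmxDl -scalemxAl.
  by rewrite mulmxDr -scalemxAr.
pose e (k : 'I_m) (l : 'I_n) : tensor M N :=
  tensor_pure (p (delta_mx 0 k)) (q (delta_mx 0 l)).
have /mk_linear[g gE] :
    linear (fun B : 'M[A]_(m, n) => \sum_k \sum_l B k l *: e k l).
  move=> a x y; rewrite scaler_sumr -big_split; apply: eq_bigr => k _ /=.
  rewrite scaler_sumr -big_split; apply: eq_bigr => l _ /=.
  by rewrite !mxE scalerDl scalerA.
apply: (fgproj_retract (i := f) (p := g) _ (fgproj_mx A m n)).
apply: (tensor_ext (f := g \o f) (g := idfun)) => u v /=.
rewrite fE gE -[in RHS](ipK u) -[in RHS](jqK v).
have /mk_linear[L LE] : linear (fun r : 'rV[A]_m => tensor_pure (p r) (q (j v))).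
  by move=> a x y; rewrite linearP tensor_purePl.
rewrite -LE [X in L X]row_sum_delta linear_sum; apply: eq_bigr => k _.
rewrite linearZZ LE.
have /mk_linear[K KE] :
    linear (fun r : 'rV[A]_n => tensor_pure (p (delta_mx 0 k)) (q r)).
  by move=> a x y; rewrite linearP tensor_purePr.
rewrite -KE [X in K X]row_sum_delta (linear_sum K) scaler_sumr.
apply: eq_bigr => l _; rewrite linearZZ KE scalerA; congr (_ *: _).
by rewrite mxE big_ord1 mxE.
Qed.

End TensorTheory.

Section Submodule.
Variables (A : comNzRingType) (V : lmodType A) (S : {pred V}).

Definition submodule of submod_closed S : Type := {x : V | x \in S}.

Variable Sc : submod_closed S.
HB.instance Definition _ := SubChoice.copy (submodule Sc) {x : V | x \in S}.
HB.instance Definition _ := GRing.SubChoice_isSubLmodule.Build A V S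
  (submodule Sc) (GRing.submod_closed_semi Sc).

End Submodule.

(* The type of all finitely generated projective A-modules is too large to    *)
(* carry a ring structure in the same universe as A.  Isomorphism classes are *)
(* therefore taken among the finitely generated projective modules that are   *)
(* submodules of some A^n; every finitely generated projective module is      *)
(* isomorphic to one of these (fgproj_modelP), so it has a class (fgclass),   *)
(* and two of them have the same class iff they are isomorphic (fgclassP).    *)
(* Sums and products of classes are the classes of direct sums and tensor     *)
(* products (isoclass_addE, isoclass_mulE).                                   *)
Record fgproj_model (A : comNzRingType) := FgprojModel {
  fgm_rank : nat;
  fgm_sub : 'rV[A]_fgm_rank -> bool;
  fgm_closed : submod_closed fgm_sub;
  fgm_fgproj : fgproj (submodule fgm_closed)
}.

Definition fgm_module (A : comNzRingType) (X : fgproj_model A) : lmodType A :=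
  submodule (fgm_closed X).

HB.instance Definition _ (A : comNzRingType) := gen_eqMixin (fgproj_model A).
HB.instance Definition _ (A : comNzRingType) := gen_choiceMixin (fgproj_model A).

Section IsoClasses.
Variable A : comNzRingType.
Implicit Types (M N P : lmodType A) (X Y : fgproj_model A).

Lemma fgproj_modelP M : fgproj M -> exists X, lmod_iso M (fgm_module X).
Proof.
move=> fM; have /fgprojP[n [i [p ipK]]] := fM.
pose S : {pred 'rV[A]_n} := [pred x | `[< exists u, i u = x >]].
have SP x : reflect (exists u, i u = x) (x \in S) by exact: asboolP.
have Sc : submod_closed S.
  split; first by apply/SP; exists 0; exact: linear0.
  by move=> a x y /SP[u <-] /SP[v <-]; apply/SP; exists (a *: u + v); rewrite linearP.
have Si u : i u \in S by apply/SP; exists u.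
have iso : lmod_iso M (submodule Sc).
  apply: (@mk_iso _ M (submodule Sc) (fun u => exist _ (i u) (Si u))
    (fun x => p (val x))).
  - by move=> a x y; apply: val_inj; rewrite /= linearP.
  - by move=> u; rewrite /= ipK.
  - by case=> x Sx; apply: val_inj => /=; case/SP: (Sx) => u <-; rewrite ipK.
by exists (FgprojModel (fgproj_iso iso fM)).
Qed.

Definition fgm_iso : rel (fgproj_model A) := fun X Y =>
  `[< lmod_iso (fgm_module X) (fgm_module Y) >].

Lemma fgm_iso_equiv : equiv_class_of fgm_iso.
Proof.
split.
- by move=> X; apply/asboolP; exact: lmod_iso_refl.
- by move=> X Y; apply/asboolP/asboolP; exact: lmod_iso_sym.
- move=> Y X Z /asboolP XY /asboolP YZ; apply/asboolP.
  exact: lmod_iso_trans XY YZ.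
Qed.
Canonical fgm_equiv := EquivRelPack fgm_iso_equiv.

Definition isoclass := {eq_quot fgm_iso}.
HB.instance Definition _ : EqQuotient _ fgm_iso isoclass :=
  EqQuotient.on isoclass.
HB.instance Definition _ := Choice.on isoclass.

Definition fgclass M (fM : fgproj M) : isoclass :=
  \pi_isoclass (sval (cid (fgproj_modelP fM))).

Lemma fgclassP M N (fM : fgproj M) (fN : fgproj N) :
  fgclass fM = fgclass fN <-> lmod_iso M N.
Proof.
rewrite /fgclass; case: cid => X MX; case: cid => Y NY /=; split.
  move=> /eqmodP/asboolP XY.
  exact: lmod_iso_trans MX (lmod_iso_trans XY (lmod_iso_sym NY)).
move=> MN; apply/eqmodP/asboolP.
exact: lmod_iso_trans (lmod_iso_sym MX) (lmod_iso_trans MN NY).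
Qed.

Definition class_module (x : isoclass) : lmodType A := fgm_module (repr x).

Lemma class_module_fgproj x : fgproj (class_module x).
Proof. exact: fgm_fgproj. Qed.

Lemma class_moduleK x : fgclass (class_module_fgproj x) = x.
Proof.
rewrite /fgclass; case: cid => X xX /=; rewrite -[RHS]reprK.
by apply/eqmodP/asboolP; exact: lmod_iso_sym.
Qed.

Lemma fgclass_module M (fM : fgproj M) : lmod_iso (class_module (fgclass fM)) M.
Proof. by apply/(fgclassP (class_module_fgproj _) fM); rewrite class_moduleK. Qed.

Definition isoclass_zero : isoclass := fgclass (fgproj_mx A 1 0).
Definition isoclass_one : isoclass := fgclass (fgproj_regular A).
Definition isoclass_add (x y : isoclass) : isoclass :=
  fgclass (fgproj_pair (class_module_fgproj x) (class_module_fgproj y)).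
Definition isoclass_mul (x y : isoclass) : isoclass :=
  fgclass (fgproj_tensor (class_module_fgproj x) (class_module_fgproj y)).

Lemma pair_iso M N M' N' : lmod_iso M M' -> lmod_iso N N' ->
  lmod_iso (M * N)%type (M' * N')%type.
Proof.
move=> /lmod_iso_elim[f [g [fK gK]]] /lmod_iso_elim[f' [g' [f'K g'K]]].
apply: (@mk_iso _ _ _ (fun x : M * N => (f x.1, f' x.2))
                      (fun y : M' * N' => (g y.1, g' y.2))).
- by move=> a x y; rewrite /= !linearP.
- by move=> [x y]; rewrite /= fK f'K.
- by move=> [x y]; rewrite /= gK g'K.
Qed.

Lemma isoclass_addE M N (fM : fgproj M) (fN : fgproj N) :
  isoclass_add (fgclass fM) (fgclass fN) = fgclass (fgproj_pair fM fN).
Proof. by apply/fgclassP; apply: pair_iso; exact: fgclass_module. Qed.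

Lemma isoclass_mulE M N (fM : fgproj M) (fN : fgproj N) :
  isoclass_mul (fgclass fM) (fgclass fN) = fgclass (fgproj_tensor fM fN).
Proof. by apply/fgclassP; apply: tensor_iso; exact: fgclass_module. Qed.

Lemma isoclass_ind (K : isoclass -> Prop) :
  (forall M (fM : fgproj M), K (fgclass fM)) -> forall x, K x.
Proof. by move=> H x; rewrite -[x]class_moduleK. Qed.

Fact isoclass_addA : associative isoclass_add.
Proof.
elim/isoclass_ind=> M fM; elim/isoclass_ind=> N fN; elim/isoclass_ind=> P fP.
rewrite !isoclass_addE; apply/fgclassP.
by apply: (@mk_iso _ _ _ (fun x : M * (N * P) => (x.1, x.2.1, x.2.2))
  (fun y : M * N * P => (y.1.1, (y.1.2, y.2)))) => // [[? []]|[[]]].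
Qed.

Fact isoclass_addC : commutative isoclass_add.
Proof.
elim/isoclass_ind=> M fM; elim/isoclass_ind=> N fN.
rewrite !isoclass_addE; apply/fgclassP.
by apply: (@mk_iso _ _ _ (fun x : M * N => (x.2, x.1))
  (fun y : N * M => (y.2, y.1))) => // [[]|[]].
Qed.

Fact isoclass_add0 : left_id isoclass_zero isoclass_add.
Proof.
elim/isoclass_ind=> M fM; rewrite isoclass_addE; apply/fgclassP.
apply: (@mk_iso _ _ _ (fun x : 'rV[A]_0 * M => x.2) (fun y => (0, y))) => //.
by case=> x y; rewrite [x]thinmx0.
Qed.

HB.instance Definition _ := GRing.isNmodule.Build isoclass
  isoclass_addA isoclass_addC isoclass_add0.

Fact isoclass_mulA : associative isoclass_mul.
Proof.
elim/isoclass_ind=> M fM; elim/isoclass_ind=> N fN; elim/isoclass_ind=> P fP.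
by rewrite !isoclass_mulE; apply/fgclassP; exact: tensor_isoA.
Qed.

Fact isoclass_mulC : commutative isoclass_mul.
Proof.
elim/isoclass_ind=> M fM; elim/isoclass_ind=> N fN.
by rewrite !isoclass_mulE; apply/fgclassP; exact: tensor_isoC.
Qed.

Fact isoclass_mul1 : left_id isoclass_one isoclass_mul.
Proof.
elim/isoclass_ind=> M fM.
by rewrite isoclass_mulE; apply/fgclassP; exact: tensor_iso1.
Qed.

Fact isoclass_mulDl : left_distributive isoclass_mul isoclass_add.
Proof.
elim/isoclass_ind=> M fM; elim/isoclass_ind=> N fN; elim/isoclass_ind=> P fP.
rewrite !(isoclass_mulE, isoclass_addE); apply/fgclassP; exact: tensor_isoDl.
Qed.

Fact isoclass_mul0 : left_zero isoclass_zero isoclass_mul.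
Proof.
elim/isoclass_ind=> M fM.
by rewrite isoclass_mulE; apply/fgclassP; exact: tensor_iso0.
Qed.

HB.instance Definition _ := GRing.Nmodule_isComPzSemiRing.Build isoclass
  isoclass_mulA isoclass_mulC isoclass_mul1 isoclass_mulDl isoclass_mul0.

End IsoClasses.

(* A pair (a, b) stands for the formal difference a - b.                      *)
Section GrothendieckRing.
Variable S : comPzSemiRingType.

Definition groth_rel : rel (S * S) := fun p q =>
  `[< exists e, p.1 + q.2 + e = q.1 + p.2 + e >].

Lemma groth_rel_equiv : equiv_class_of groth_rel.
Proof.
split.
- by move=> p; apply/asboolP; exists 0.
- by move=> p q; apply/asboolP/asboolP => -[e eE]; exists e.
- move=> q p r /asboolP[e eE] /asboolP[f fE]; apply/asboolP.
  exists (q.1 + q.2 + e + f).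
  transitivity ((p.1 + q.2 + e) + (q.1 + r.2 + f)); first by ring.
  by rewrite eE fE; ring.
Qed.
Canonical groth_equiv := EquivRelPack groth_rel_equiv.

Definition groth := {eq_quot groth_rel}.
HB.instance Definition _ : EqQuotient _ groth_rel groth := EqQuotient.on groth.
HB.instance Definition _ := Choice.on groth.

Implicit Types (x y z : groth) (p q r : S * S).

Definition groth_add x y : groth :=
  \pi_groth ((repr x).1 + (repr y).1, (repr x).2 + (repr y).2).
Definition groth_opp x : groth := \pi_groth ((repr x).2, (repr x).1).
Definition groth_mul x y : groth :=
  \pi_groth ((repr x).1 * (repr y).1 + (repr x).2 * (repr y).2,
             (repr x).1 * (repr y).2 + (repr x).2 * (repr y).1).

Lemma groth_eqP p q : \pi_groth p = \pi_groth q <->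
  exists e, p.1 + q.2 + e = q.1 + p.2 + e.
Proof. by split=> [/eqmodP/asboolP|pq]; last exact/eqmodP/asboolP. Qed.

Lemma groth_repr p : exists e,
  (repr (\pi_groth p)).1 + p.2 + e = p.1 + (repr (\pi_groth p)).2 + e.
Proof. by apply/groth_eqP; rewrite reprK. Qed.

Lemma groth_addE p q :
  groth_add (\pi_groth p) (\pi_groth q) = \pi_groth (p.1 + q.1, p.2 + q.2).
Proof.
apply/groth_eqP => /=.
have [e eE] := groth_repr p; have [f fE] := groth_repr q; exists (e + f).
move: (repr (\pi_groth p)) (repr (\pi_groth q)) eE fE => p' q' eE fE.
transitivity ((p'.1 + p.2 + e) + (q'.1 + q.2 + f)); first by ring.
by rewrite eE fE; ring.
Qed.

Lemma groth_oppE p : groth_opp (\pi_groth p) = \pi_groth (p.2, p.1).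
Proof.
apply/groth_eqP => /=; have [e eE] := groth_repr p; exists e.
by rewrite addrC [in LHS]addrC [_ + p.1]addrC -eE; ring.
Qed.

Lemma groth_mulE p q : groth_mul (\pi_groth p) (\pi_groth q) =
  \pi_groth (p.1 * q.1 + p.2 * q.2, p.1 * q.2 + p.2 * q.1).
Proof.
apply: (etrans (y := \pi_groth (p.1 * (repr (\pi_groth q)).1 + p.2 * (repr (\pi_groth q)).2,
  p.1 * (repr (\pi_groth q)).2 + p.2 * (repr (\pi_groth q)).1))).
  apply/groth_eqP => /=; have [e eE] := groth_repr p.
  move: (repr (\pi_groth p)) (repr (\pi_groth q)) eE => p' q' eE.
  exists (e * q'.1 + e * q'.2).
  transitivity ((p'.1 + p.2 + e) * q'.1 + (p.1 + p'.2 + e) * q'.2); first by ring.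
  transitivity ((p.1 + p'.2 + e) * q'.1 + (p'.1 + p.2 + e) * q'.2).
    by rewrite eE.
  by ring.
apply/groth_eqP => /=; have [e eE] := groth_repr q.
move: (repr (\pi_groth q)) eE => q' eE.
exists (p.1 * e + p.2 * e).
transitivity (p.1 * (q'.1 + q.2 + e) + p.2 * (q.1 + q'.2 + e)); first by ring.
transitivity (p.1 * (q.1 + q'.2 + e) + p.2 * (q'.1 + q.2 + e)).
  by rewrite eE.
by ring.
Qed.

Lemma groth_ind (K : groth -> Prop) :
  (forall p, K (\pi_groth p)) -> forall x, K x.
Proof. by move=> H x; rewrite -[x]reprK. Qed.

Fact groth_addA : associative groth_add.
Proof.
elim/groth_ind=> p; elim/groth_ind=> q; elim/groth_ind=> r.
by rewrite !groth_addE /= !addrA.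
Qed.

Fact groth_addC : commutative groth_add.
Proof.
elim/groth_ind=> p; elim/groth_ind=> q; rewrite !groth_addE.
by rewrite [p.1 + _]addrC [p.2 + _]addrC.
Qed.

Fact groth_add0 : left_id (\pi_groth (0, 0)) groth_add.
Proof. by elim/groth_ind=> -[a b]; rewrite groth_addE /= !add0r. Qed.

Fact groth_addN : left_inverse (\pi_groth (0, 0)) groth_opp groth_add.
Proof.
elim/groth_ind=> p; rewrite groth_oppE groth_addE; apply/groth_eqP.
by exists 0 => /=; ring.
Qed.

HB.instance Definition _ := GRing.isZmodule.Build groth
  groth_addA groth_addC groth_add0 groth_addN.

Fact groth_mulA : associative groth_mul.
Proof.
elim/groth_ind=> p; elim/groth_ind=> q; elim/groth_ind=> r.
by rewrite !groth_mulE /=; apply/groth_eqP; exists 0 => /=; ring.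
Qed.

Fact groth_mulC : commutative groth_mul.
Proof.
elim/groth_ind=> p; elim/groth_ind=> q.
by rewrite !groth_mulE /=; apply/groth_eqP; exists 0 => /=; ring.
Qed.

Fact groth_mul1 : left_id (\pi_groth (1, 0)) groth_mul.
Proof.
elim/groth_ind=> p.
by rewrite !groth_mulE /=; apply/groth_eqP; exists 0 => /=; ring.
Qed.

Fact groth_mulDl : left_distributive groth_mul groth_add.
Proof.
elim/groth_ind=> p; elim/groth_ind=> q; elim/groth_ind=> r.
rewrite !(groth_mulE, groth_addE) /=; apply/groth_eqP.
by exists 0 => /=; ring.
Qed.

HB.instance Definition _ := GRing.Zmodule_isComPzRing.Build groth
  groth_mulA groth_mulC groth_mul1 groth_mulDl.

End GrothendieckRing.

Definition K0 (A : comNzRingType) : comPzRingType := groth (isoclass A).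

Section Spectrum.
Variable A : comNzRingType.

Record spec := Spec {
  spec_ideal : A -> bool;
  spec_idealP : idealr_closed (spec_ideal : {pred A});
  spec_primeP : prime_idealr_closed (spec_ideal : {pred A})
}.

HB.instance Definition _ := gen_eqMixin spec.
HB.instance Definition _ := gen_choiceMixin spec.

Implicit Type p : spec.

Definition zariski_closed_set (E : set A) : set spec :=
  [set p | forall a, E a -> spec_ideal p a].

Definition zariski_open : set_system spec :=
  [set U | exists E : set A, U = ~` zariski_closed_set E].

Fact zariski_openT : zariski_open setT.
Proof.
exists setT; apply/seteqP; split=> // p _ /(_ 1 I) p1.
by have [_ /negP] := spec_idealP p.
Qed.

Fact zariski_openI : setI_closed zariski_open.
Proof.
move=> _ _ [E ->] [F ->].
exists [set x | exists a b, [/\ E a, F b & x = a * b]].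
rewrite -setCU; congr (~` _); apply/seteqP; split=> p.
  have [p0 _ pD] := spec_idealP p.
  have pM a b : spec_ideal p b -> spec_ideal p (a * b).
    by move=> pb; have := pD a b 0 pb p0; rewrite addr0.
  by case=> pV _ [a [b [Ea Fb ->]]]; [rewrite mulrC|]; apply: pM; exact: pV.
move=> pV; apply: contrapT => /not_orP[].
move=> /existsNP[a /not_implyP[Ea pa]] /existsNP[b /not_implyP[Fb pb]].
have /spec_primeP/orP[] : a * b \in (spec_ideal p : {pred A}).
  by apply: pV; exists a, b.
- exact: pa.
- exact: pb.
Qed.

Fact zariski_openU (I : Type) (f : I -> set spec) :
  (forall i, zariski_open (f i)) -> zariski_open (\bigcup_i f i).
Proof.
move=> fo; pose E i := sval (cid (fo i)).
have fE i : f i = ~` zariski_closed_set (E i) by rewrite /E; case: cid.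
exists (\bigcup_i E i); apply/seteqP; split=> p.
  move=> [i _]; rewrite fE => pi; apply: contra_not pi => pV a Ea.
  by apply: pV; exists i.
move=> pV; apply: contrapT => pf; apply: pV => a [i _ Ea].
apply: contrapT => pa; apply: pf; exists i => //; rewrite fE => /(_ a Ea).
exact: pa.
Qed.

HB.instance Definition _ := isOpenTopological.Build spec
  zariski_openT zariski_openI zariski_openU.

End Spectrum.

Section H0.
Variable A : comNzRingType.

Definition H0_pred : {pred spec A -> int} := fun f =>
  `[< continuous (f : spec A -> discrete_topology int) >].

Lemma H0_predP (f : spec A -> int) :
  f \in H0_pred <-> forall p : spec A, \forall q \near p, f q = f p.
Proof.
split=> [/asboolP fc p|fp]; last first.
  apply/asboolP => p; apply/discrete_cvg; last exact: fp.
  by apply: fmap_filter; exact: nbhs_filter.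
have FF : Filter ((f : _ -> discrete_topology int) @ p).
  by apply: fmap_filter; exact: nbhs_filter.
exact: ((discrete_cvg _ (f p : discrete_topology int) FF).1 (fc p)).
Qed.

Fact H0_subring_closed : subring_closed H0_pred.
Proof.
split.
- by apply/H0_predP => p; exact: filterE.
- move=> f g /H0_predP fc /H0_predP gc; apply/H0_predP => p.
  by apply: filterS2 (fc p) (gc p) => q fq gq; rewrite /= !fctE fq gq.
- move=> f g /H0_predP fc /H0_predP gc; apply/H0_predP => p.
  by apply: filterS2 (fc p) (gc p) => q fq gq; rewrite /= !fctE fq gq.
Qed.

Definition H0_type : Type := {f : spec A -> int | f \in H0_pred}.
HB.instance Definition _ := SubChoice.copy H0_type {f : spec A -> int | f \in H0_pred}.
HB.instance Definition _ := GRing.SubChoice_isSubComPzRing.Build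
  (spec A -> int) H0_pred H0_type H0_subring_closed.

End H0.

Definition H0 (A : comNzRingType) : comPzRingType := H0_type A.

(* [pchar R] only records the primes p such that p%:R = 0, so it is also empty *)
(* for rings such as Z/4; characteristic zero is stated on all integers.      *)
Definition char_zero (R : pzRingType) : Prop :=
  forall n : nat, n%:R = 0 :> R -> n = 0%N.

(* Main.v *)
Require Import Defs.
From mathcomp Require Import all_boot all_order all_algebra.
From mathcomp Require Import all_classical.

(** For H_0, evaluate at a prime ideal, which exists by Zorn's lemma.  For K_0,
    if n = 0 with n > 0 then A^n (+) M ~ M for some finitely generated
    projective M, hence A^(kn) (+) M ~ M for all k.  As M is a retract of some
    A^m, so is every A^(kn); but a retract A^a of A^m has a <= m, since the
    identity of A^a factors through square matrices one of which has a zero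
    row or column when a > m. *)

Import GRing.Theory Num.Theory.

Local Open Scope ring_scope.
Local Open Scope classical_set_scope.
Local Open Scope quotient_scope.

(** The naturals embed through [n%:R]: if [n < m] had equal images, the nonzero integer [m - n]
    would vanish in [R]. *)
Lemma char_zero_infinite (R : pzRingType) :
  char_zero R -> infinite_set [set: R].
Proof.
move=> R0; have natr_le m n : m%:R = n%:R :> R -> (m <= n)%N.
  move=> mn; rewrite -subn_eq0; apply/eqP.
  have [/eqP//|/ltnW nm] := leqP m n.
  by apply: R0; rewrite natrB // mn subrr.
have natr_inj : injective (fun n : nat => n%:R : R).
  by move=> m n mn; apply/eqP; rewrite eqn_leq !natr_le.
move=> Rfin; apply: infinite_nat.
rewrite -(preimage_setT (fun n : nat => n%:R : R)).
by apply: finite_preimage Rfin => m n _ _; exact: natr_inj.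
Qed.

(** Zorn yields a maximal proper ideal, and maximal ideals are prime. *)
Lemma spec_inhabited (A : comNzRingType) : exists p : spec A, True.
Proof.
(* Zorn_bigcup also considers the empty chain, so the empty set is allowed. *)
pose is_proper (I : set A) :=
  (forall a x y, I x -> I y -> I (a * x + y)) /\ ~ I 1.
have [F FP totF|I [[IP I1] Imax]] := @Zorn_bigcup A is_proper.
  split=> [a x y [I FI Ix] [J FJ Jy]|[I FI I1]]; last by case: (FP I FI).
  have [[IP _] [JP _]] := (FP I FI, FP J FJ).
  have [IJ|JI] := totF I J FI FJ.
    by exists J => //; apply: JP => //; exact: IJ.
  by exists I => //; apply: IP => //; exact: JI.
(* The maximal set is not empty: otherwise the zero ideal, proper since [1 != 0], would strictly
   contain it. *)
have I0 : I 0.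
  have [[x Ix]|/set0P/negP/negPn/eqP I_0] := pselect (I !=set0).
    by have := IP (-1) x x Ix Ix; rewrite mulN1r addNr.
  exfalso; apply: (Imax [set 0]).
    by rewrite I_0 properEneq; split => //; apply/eqP => /seteqP[_ /(_ 0 erefl)].
  split=> [a x y /= -> ->|/= /eqP]; first by rewrite mulr0 addr0.
  by rewrite oner_eq0.
have IM a x : I x -> I (a * x) by move=> Ix; rewrite -[_ * _]addr0; exact: IP.
have Iideal : idealr_closed ((fun a => `[< I a >]) : {pred A}).
  split; first exact/asboolP.
    by apply/negP => /asboolP.
  by move=> a x y /asboolP Ix /asboolP Iy; apply/asboolP; exact: IP.
have Iprime : prime_idealr_closed ((fun a => `[< I a >]) : {pred A}).
  move=> x y /asboolP Ixy; have [Ix|nIx] := pselect (I x).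
    by apply/orP; left; apply/asboolP.
  apply/orP; right; apply/asboolP.
  (* [J] is the ideal [I + (x)]. Maximality forces [1 = i + a * x], so [y = i * y + a * (x * y)]
     lies in [I]. *)
  pose J : set A := [set z | exists i a, I i /\ z = i + a * x].
  have J1 : J 1.
    apply: contrapT => nJ1; apply: (Imax J); last first.
      split=> // a u v [i [b [Ii ->]]] [j [c [Ij ->]]].
      exists (a * i + j), (a * b + c); split; first exact: IP.
      by rewrite mulrDr mulrDl mulrA addrACA.
    split=> [i Ii|JI]; first by exists i, 0; rewrite mul0r addr0.
    by apply/nIx/JI; exists 0, 1; rewrite add0r mul1r.
  have [i [a [Ii e1]]] := J1.
  rewrite -[y]mul1r e1 mulrDl -mulrA addrC; apply: IP => //.
  by rewrite mulrC; exact: IM.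
by exists (Spec Iideal Iprime).
Qed.

Lemma H0_char_zero (A : comNzRingType) : char_zero (H0 A).
Proof.
move=> n n0; have [p _] := spec_inhabited A.
have valn k : (val (k%:R : H0 A) : spec A -> int) p = k%:R.
  by elim: k => // k IHk; rewrite !mulrS -IHk.
have := valn n; rewrite n0 => /esym/eqP.
by rewrite [X in _ == X](_ : _ = 0) // pnatr_eq0 => /eqP.
Qed.

Lemma mulmx1_leq (A : comNzRingType) (a m : nat)
    (B : 'M[A]_(a, m)) (C : 'M[A]_(m, a)) :
  B *m C = 1%:M -> (a <= m)%N.
Proof.
(* If [m < a], then [a] is rewritten as [m + k.+1], so the zero padding has at least one column, the
   one at [rshift m ord0]. *)
move=> BC; case: leqP => // /subnKC; rewrite addSnnS => am.
move: B C BC; rewrite -am; move: (a - m.+1)%N => k B C BC.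
have : row_mx B (0 : 'M_(m + k.+1, k.+1)) *m col_mx C 0 = 1%:M.
  by rewrite mul_row_col mul0mx addr0.
move=> /(congr1 determinant); rewrite det_mulmx det1.
rewrite (expand_det_col _ (rshift m ord0)) big1.
  by move/eqP; rewrite mul0r eq_sym oner_eq0.
by move=> i _; rewrite row_mxEr mxE mul0r.
Qed.

Lemma free_retract_leq (A : comNzRingType) (a m : nat)
    (f : {linear 'rV[A]_a -> 'rV[A]_m}) (g : {linear 'rV[A]_m -> 'rV[A]_a}) :
  cancel f g -> (a <= m)%N.
Proof.
move=> fK; apply: (@mulmx1_leq A a m (lin1_mx f) (lin1_mx g)).
by apply/row_matrixP => i; rewrite !rowE mulmxA !mul_rV_lin1 mulmx1 fK.
Qed.

(** Induction splits off the first coordinate of a row vector; the zero class is that of ['rV[A]_0]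
    by definition. *)
Lemma isoclass_natr (A : comNzRingType) (n : nat) :
  n%:R = fgclass (fgproj_mx A 1 n) :> isoclass A.
Proof.
elim: n => [//|n IHn]; rewrite mulrS IHn.
rewrite [LHS]isoclass_addE; apply/fgclassP.
apply: (@mk_iso _ _ _
  (fun x : A^o * 'rV[A]_n => row_mx (const_mx x.1 : 'M[A]_1) x.2 : 'rV[A]_(1 + n))
  (fun y : 'rV[A]_(1 + n) => (lsubmx y 0 0 : A^o, rsubmx y))).
- move=> a x y; rewrite scale_row_mx add_row_mx; congr row_mx.
  by apply/matrixP => i j; rewrite !mxE.
- by move=> [x y]; rewrite /= row_mxKl row_mxKr mxE.
- move=> y; rewrite -[RHS]hsubmxK; congr row_mx.
  by apply/matrixP => i j; rewrite mxE !ord1.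
Qed.

Lemma isoclass_natr_absorb (A : comNzRingType) (n : nat) (e : isoclass A) :
  n%:R + e = e -> n = 0%N.
Proof.
move=> ne; have [m [i [p ipK]]] := (fgprojP _).1 (class_module_fgproj e).
have nke k : (n * k)%:R + e = e.
  by elim: k => [|k IHk]; rewrite ?muln0 ?add0r // mulnS natrD -addrA IHk.
(* With [m.+1] copies the free rank [n * m.+1] exceeds [m] unless [n = 0]. *)
have := nke m.+1; rewrite isoclass_natr -{1}[e]class_moduleK.
rewrite -[RHS]class_moduleK [LHS]isoclass_addE => /fgclassP.
move=> /lmod_iso_elim[f [g [fK gK]]].
(* [u] includes the free summand and then embeds the module in ['rV[A]_m]; [v] below retracts it. *)
have /mk_linear[u uE] : linear (fun x => i (f (x, 0))).
  move=> a x y; rewrite -!linearP; congr (i (f _)).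
  by congr pair; rewrite /= scaler0 addr0.
have /mk_linear[v vE] : linear (fun y => (g (p y)).1).
  by move=> a x y; rewrite !linearP.
have /free_retract_leq : cancel u v by move=> x; rewrite uE vE ipK fK.
by case: n {ne nke f g fK gK u v uE vE} => // n; rewrite mulSn leqNgt leq_addr.
Qed.

Lemma groth_natr (S : comPzSemiRingType) (n : nat) :
  n%:R = \pi_(groth S) (n%:R, 0) :> groth S.
Proof.
elim: n => [//|n IHn]; rewrite !mulrS IHn.
by rewrite [LHS]groth_addE /= addr0.
Qed.

(** Vanishing of [n] in [K0 A] only gives [n%:R + e = e] for some class [e], which is the situation
    of [isoclass_natr_absorb]. *)
Lemma K0_char_zero (A : comNzRingType) : char_zero (K0 A).
Proof.
move=> n; rewrite groth_natr => /groth_eqP[e] /=.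
by rewrite addr0 add0r add0r => /isoclass_natr_absorb.
Qed.

Theorem corollary4p13 (A : comNzRingType) :
  (infinite_set [set: K0 A] /\ char_zero (K0 A)) /\
  (infinite_set [set: H0 A] /\ char_zero (H0 A)).
Proof.
have K := K0_char_zero A; have H := H0_char_zero A.
by split; split=> //; exact: char_zero_infinite.
Qed.
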